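(* For every $n\geq 1$ there exists an irreducible, triangle-free, $3$-colorable graph $G_n=(V_n,E_n)$ with $\Theta(n)$ vertices such that $\mathrm{diam}(G_n)=2$, the minimum degree of $G_n$ is $\delta(G_n)=\Theta(\sqrt{n})$, and the minimum size of a dominating set of $G_n$ is $\Theta(\sqrt{n})$.
   Context: Graphs are finite, simple and undirected. For a vertex $u$, $N(u)$ is its set of neighbors. A dominating set of $G$ is a set $D$ of vertices such that every vertex outside $D$ has a neighbor in $D$. The diamond is the graph on $4$ vertices with $5$ edges ($K_4$ minus one edge). A graph $G$ is called irreducible if it contains no $K_4$ as an induced subgraph, contains no induced diamond, and has no two distinct vertices $u,v$ with $N(u)\subseteq N(v)$. *)

(* Defs.v *)
From mathcomp Require Import all_boot.
Set Implicit Arguments.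
Unset Strict Implicit.
Unset Printing Implicit Defensive.

Record sgraph := SGraph {
  vertex :> finType;
  adj : rel vertex;
  adj_sym : symmetric adj;
  adj_irrefl : irreflexive adj }.

Definition nbhd (G : sgraph) (u : G) : {set G} := [set v | adj u v].

Definition induced_subgraph (H G : sgraph) : Prop :=
  exists2 f : H -> G, injective f & forall x y, adj (f x) (f y) = adj x y.

Section Complete.
Variable k : nat.
Definition complete_rel : rel 'I_k := fun i j => i != j.
Lemma complete_sym : symmetric complete_rel.
Proof. by move=> i j; rewrite /complete_rel eq_sym. Qed.
Lemma complete_irrefl : irreflexive complete_rel.
Proof. by move=> i; rewrite /complete_rel eqxx. Qed.
Definition complete : sgraph := SGraph complete_sym complete_irrefl.
End Complete.

(* K_4 without the edge between 0 and 1. *)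
Definition diamond_rel : rel 'I_4 :=
  fun i j => (i != j) && ~~ ((i < 2) && (j < 2)).
Lemma diamond_sym : symmetric diamond_rel.
Proof. by move=> i j; rewrite /diamond_rel eq_sym (andbC (i < 2)). Qed.
Lemma diamond_irrefl : irreflexive diamond_rel.
Proof. by move=> i; rewrite /diamond_rel eqxx. Qed.
Definition diamond : sgraph := SGraph diamond_sym diamond_irrefl.

Definition irreducible (G : sgraph) : Prop :=
  [/\ ~ induced_subgraph (complete 4) G,
      ~ induced_subgraph diamond G
    & forall u v : G, u != v -> ~~ (nbhd u \subset nbhd v)].

(* A triangle is a complete graph, so a copy of it is automatically induced. *)
Definition triangle_free (G : sgraph) : Prop :=
  ~ induced_subgraph (complete 3) G.

Definition colorable (k : nat) (G : sgraph) : Prop :=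
  exists c : G -> 'I_k, forall u v : G, adj u v -> c u != c v.

Definition walk (G : sgraph) (u v : G) (k : nat) : Prop :=
  exists p : seq G, [/\ path (@adj G) u p, last u p = v & size p = k].

Definition is_dist (G : sgraph) (u v : G) (k : nat) : Prop :=
  walk u v k /\ forall j, walk u v j -> k <= j.

(* Disconnected graphs and the empty graph have no diameter in this sense. *)
Definition is_diam (G : sgraph) (d : nat) : Prop :=
  (forall u v : G, exists2 k, is_dist u v k & k <= d) /\
  (exists u v : G, is_dist u v d).

(* Every degree is smaller than #|G|, so the default value #|G| is only
   attained, with value 0, by the empty graph. *)
Definition min_degree (G : sgraph) : nat :=
  \big[minn/#|G|]_(v : G) #|nbhd v|.

Definition dominating (G : sgraph) (D : {set G}) : bool :=
  [forall (v | v \notin D), [exists u in D, adj v u]].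

(* The default value #|G| is harmless: the set of all vertices dominates. *)
Definition domination_number (G : sgraph) : nat :=
  \big[minn/#|G|]_(D : {set G} | dominating D) #|D|.

(* Main.v *)
(* Let q be a power of 2 with n <= q^2 <= 16 n. Take the points of the affine
   plane over F_q and two copies of its set of lines. A point is joined to both
   copies of each line through it, and the two copies of the line set are joined
   by parallelism of distinct lines. A triangle would need two distinct
   parallels through one point; a point p and a line l avoiding it have as common
   neighbor the other copy of the parallel to l through p. All degrees lie
   between q and 2q + 2, so that dominating the 3q^2 + 2q vertices takes at least
   q of them, whereas the neighborhood of a point is dominating. *)
Require Import Defs.
From mathcomp Require Import all_boot all_order all_algebra.
From mathcomp Require Import all_classical all_reals all_analysis.
From mathcomp Require Import finfield ring zify.
Import Order.TTheory GRing.Theory Num.Theory.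
Import numFieldNormedType.Exports.
Local Open Scope classical_set_scope.
Local Open Scope ring_scope.

Set Implicit Arguments.
Unset Strict Implicit.
Unset Printing Implicit Defensive.

(** * Irreducibility and diameter two in triangle-free graphs *)

Section Graphs.
Local Open Scope nat_scope.
Variable G : sgraph.

Hypothesis no_triangle : forall u v w : G, adj u v -> adj v w -> ~~ adj u w.

(** An embedding maps a triangle to a triangle. This excludes the triangle, [complete 4] and
    [diamond] alike. *)
Lemma not_induced_of_triangle (H : sgraph) (x y z : H) :
  adj x y -> adj y z -> adj x z -> ~ induced_subgraph H G.
Proof.
move=> xy yz xz [f _ fE].
by have := @no_triangle (f x) (f y) (f z); rewrite !fE xy yz xz => /(_ isT isT).
Qed.

Lemma triangle_freeI : triangle_free G.
Proof.
apply: (@not_induced_of_triangle (complete 3) ord0 (inord 1) (inord 2));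
  by rewrite /= /complete_rel -val_eqE /= ?inordK.
Qed.

Lemma irreducibleI :
  (forall u v : G, u != v -> exists2 w, adj u w & ~~ adj v w) -> irreducible G.
Proof.
move=> sep; split.
- apply: (@not_induced_of_triangle (complete 4) ord0 (inord 1) (inord 2));
  by rewrite /= /complete_rel -val_eqE /= ?inordK.
(* The missing edge joins 0 and 1, so 0, 2, 3 form a triangle. *)
- apply: (@not_induced_of_triangle diamond ord0 (inord 2) (inord 3));
  by rewrite /= /diamond_rel -val_eqE /= ?inordK.
- move=> u v /sep[w uw vw]; apply/fintype.subsetPn; exists w; by rewrite inE.
Qed.

Lemma is_diam2I (u0 v0 : G) :
  u0 != v0 -> ~~ adj u0 v0 ->
  (forall u v : G, u != v -> ~~ adj u v -> exists2 w, adj u w & adj w v) ->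
  is_diam G 2.
Proof.
move=> uv0 nuv0 common.
have dist2 (u v : G) : u != v -> ~~ adj u v -> is_dist u v 2.
  move=> uv nuv; split.
    by have [w uw wv] := common u v uv nuv; exists [:: w; v]; rewrite /= uw wv.
  move=> j [[|x [|y p]] [/= pp lp <-]] //; subst v.
    by rewrite eqxx in uv.
  by rewrite andbT (negPf nuv) in pp.
split; last by exists u0, v0; apply: dist2.
move=> u v; have [->|uv] := eqVneq u v.
  by exists 0 => //; split=> //; exists [::].
have [auv|nuv] := boolP (adj u v); last by exists 2 => //; apply: dist2.
exists 1 => //; split; first by exists [:: v]; rewrite /= auv.
by case=> // -[[|x p] [_ /= uv' //]]; rewrite uv' eqxx in uv.
Qed.

End Graphs.

(** * Bounds on minimum degree and domination number *)

Section Bounds.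
Local Open Scope nat_scope.
Variable G : sgraph.

(** The closed neighborhoods of the vertices of [D] cover [G], and each has at most [d.+1]
    elements. *)
Lemma card_le_dominating (d : nat) (D : {set G}) :
  (forall v : G, #|nbhd v| <= d) -> dominating D -> #|G| <= #|D| * d.+1.
Proof.
move=> degG /forallP domD.
have cov : ([set: G] \subset \bigcup_(u in D) (u |: nbhd u))%SET.
  apply/fintype.subsetP => v _; apply/finset.bigcupP.
  have [vD|vD] := boolP (v \in D); first by exists v; rewrite // setU11.
  have /existsP[u /andP[uD vu]] := implyP (domD v) vD.
  by exists u; rewrite // !inE adj_sym vu orbT.
rewrite -cardsT; apply: (leq_trans (subset_leq_card cov)).
rewrite -sum_nat_const.
apply: (@leq_trans (\sum_(u in D) #|(u |: nbhd u)%SET|)).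
  elim/big_rec2: _ => [|u m A _ le_Am]; first by rewrite cards0.
  by apply: (leq_trans (leq_card_setU _ _)); rewrite leq_add2l.
apply: leq_sum => u _; rewrite cardsU1 -add1n leq_add ?degG //.
by case: (_ \notin _).
Qed.

Lemma min_degree_le (v : G) : min_degree G <= #|nbhd v|.
Proof. exact: (@bigmin_le _ nat). Qed.

(** The condition [m <= #|G|] handles the default value of the minimum. *)
Lemma min_degree_ge (m : nat) :
  m <= #|G| -> (forall v : G, m <= #|nbhd v|) -> m <= min_degree G.
Proof. by move=> mG mdeg; apply: (@le_bigmin _ nat). Qed.

Lemma domination_number_le (D : {set G}) :
  dominating D -> domination_number G <= #|D|.
Proof. exact: (@bigmin_le_cond _ nat). Qed.

Lemma domination_number_ge (m : nat) :
  m <= #|G| -> (forall D : {set G}, dominating D -> m <= #|D|) ->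
  m <= domination_number G.
Proof. by move=> mG mD; apply: (@le_bigmin _ nat). Qed.

End Bounds.

Lemma exists_neq2 (T : finType) (b c : T) :
  (2 < #|T|)%N -> exists2 d, d != b & d != c.
Proof.
move=> T3; have : ~~ ([set: T]%SET \subset [set b; c]%SET).
  by apply/negP => /subset_leq_card; rewrite cardsT cards2; lia.
by case/fintype.subsetPn => d _; rewrite !inE negb_or => /andP[]; exists d.
Qed.

(** * Incidence in the affine plane and the graph built on it *)

Section AffinePlane.
Variable F : finFieldType.

(* A line is a pair of a slope and an intercept: [(Some a, b)] is the line
   y = a x + b and [(None, b)] is the vertical line x = b. Thus a point lies on
   [(s, b)] when its intercept for the slope s is b, and parallel means having
   the same slope. *)
Definition intercept (p : F * F) (s : option F) : F :=
  if s is Some a then p.2 - a * p.1 else p.1.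

Definition line_point (s : option F) (b t : F) : F * F :=
  if s is Some a then (t, a * t + b) else (b, t).

Lemma intercept_line_point s b t : intercept (line_point s b t) s = b.
Proof. by case: s => [a|] //=; ring. Qed.

Lemma line_point_inj s b : injective (line_point s b).
Proof. by case: s => [a|] x y []. Qed.

Lemma on_lineP p s b : intercept p s = b -> exists t, p = line_point s b t.
Proof.
case: p s => x y [a|] /= <-; last by exists y.
by exists x; congr pair; ring.
Qed.

Lemma lines_meet s t b c :
  s != t -> exists2 p, intercept p s = b & intercept p t = c.
Proof.
case: s t => [a|] [a'|] //= neq.
- have aa' : a' - a != 0.
    by rewrite subr_eq0; apply: contra neq => /eqP ->.
  (* The abscissa solves a x + b = a' x + c. *)
  exists ((b - c) / (a' - a), b + a * ((b - c) / (a' - a))) => /=; first by ring.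
  by field.
- by exists (c, b + a * c) => /=; ring.
- by exists (b, c + a' * b) => /=; ring.
Qed.

Lemma points_join p p' : exists s, intercept p s = intercept p' s.
Proof.
case: p p' => x y [x' y']; have [<-|xx'] := eqVneq x x'; first by exists None.
exists (Some ((y - y') / (x - x'))) => /=; field.
by rewrite subr_eq0.
Qed.

Lemma points_separated p p' :
  p != p' -> exists s, intercept p s != intercept p' s.
Proof.
case: p p' => x y [x' y']; have [<-|xx'] := eqVneq x x'; last by exists None.
rewrite xpair_eqE eqxx /= => yy'; exists (Some 0) => /=.
by rewrite !mul0r !subr0.
Qed.

Lemma lines_separated s b t c :
  (s, b) != (t, c) -> exists2 p, intercept p s = b & intercept p t != c.
Proof.
have [<-|st _] := eqVneq s t.
  rewrite xpair_eqE eqxx /= => bc; exists (line_point s b 0).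
    exact: intercept_line_point.
  by rewrite intercept_line_point.
(* The first line is cut with a parallel of the second other than the second itself. *)
have [p ps pt] := lines_meet b (c + 1) st; exists p => //.
by rewrite pt -subr_eq0 addrAC subrr add0r oner_eq0.
Qed.

(* The boolean distinguishes the two copies of the set of lines. *)
Definition plane_vertex := (F * F + bool * (option F * F))%type.

Definition plane_rel : rel plane_vertex := fun u v =>
  match u, v with
  | inl _, inl _ => false
  | inl p, inr (_, (s, b)) | inr (_, (s, b)), inl p => intercept p s == b
  | inr (i, (s, b)), inr (j, (t, c)) => [&& i != j, s == t & b != c]
  end.

Lemma plane_sym : symmetric plane_rel.
Proof.
by move=> [p|[i [s b]]] [p'|[j [t c]]] //=; rewrite eq_sym [s == t]eq_sym
  [b == c]eq_sym.
Qed.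

Lemma plane_irrefl : irreflexive plane_rel.
Proof. by move=> [p|[i [s b]]] //=; rewrite eqxx. Qed.

Definition plane_graph := SGraph plane_sym plane_irrefl.

Lemma plane_no_triangle (u v w : plane_graph) :
  adj u v -> adj v w -> ~~ adj u w.
Proof.
case: u v w => [p|[i [s b]]] [p'|[j [t c]]] [p''|[k [r d]]] //=.
- by move=> /eqP<- /and3P[_ /eqP<- ne].
- by move=> /eqP<- /eqP<-; apply/and3P => -[_ /eqP<-]; rewrite eqxx.
- by move=> /and3P[_ /eqP-> ne] /eqP pc; rewrite pc eq_sym.
(* Three mutually adjacent lines would need three distinct booleans. *)
- by move=> /and3P[ij _ _] /and3P[jk _ _]; case: i j k ij jk => [] [] [].
Qed.

Lemma plane_colorable : colorable 3 plane_graph.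
Proof.
exists (fun u : plane_graph => match u with
  | inl _ => inord 0 | inr (i, _) => if i then inord 1 else inord 2 end).
by move=> [p|[i [s b]]] [p'|[j [t c]]] //=; move=> h;
  rewrite -val_eqE /=; move: h; try case: i; try case: j => //;
  rewrite ?inordK.
Qed.

(** * Degrees and domination in the plane graph *)

Lemma card_plane : #|plane_graph| = (#|F| * #|F| + 2 * (#|F|.+1 * #|F|))%N.
Proof. by rewrite /= card_sum !card_prod card_bool card_option. Qed.

(** Each of the q + 1 slopes gives one line through [p], in two copies. *)
Lemma card_nbhd_point p : #|nbhd (inl p : plane_graph)| = (2 * #|F|.+1)%N.
Proof.
pose f (x : bool * option F) : plane_graph :=
  inr (x.1, (x.2, intercept p x.2)).
have f_inj : injective f by move=> [i s] [j t] [-> ->].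
rewrite -card_bool -card_option -card_prod -(card_imset _ f_inj).
apply: eq_card => -[p'|[i [s b]]]; rewrite inE /=.
  by apply/esym/imsetP => -[].
apply/eqP/imsetP => [<-|[[j t] _ [_ -> ->]] //].
by exists (i, s).
Qed.

Lemma card_nbhd_line_le l : (#|nbhd (inr l : plane_graph)| <= 2 * #|F|)%N.
Proof.
case: l => i [s b].
(* At [(false, b)] the value is the other copy of the line itself, not a neighbor, so this only
   bounds from above. *)
pose f (x : bool * F) : plane_graph :=
  if x.1 then inl (line_point s b x.2) else inr (~~ i, (s, x.2)).
rewrite -card_bool -card_prod; apply: leq_trans (leq_imset_card f _).
apply: subset_leq_card; apply/fintype.subsetP => -[p|[j [t c]]]; rewrite inE /=.
  by move=> /eqP/on_lineP[x ->]; apply/imsetP; exists (true, x).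
move=> /and3P[ij /eqP<- _]; apply/imsetP; exists (false, c) => //.
by rewrite {}/f /=; case: i j ij => [] [].
Qed.

Lemma card_nbhd_line_ge l : (#|F| <= #|nbhd (inr l : plane_graph)|)%N.
Proof.
case: l => i [s b].
pose f t : plane_graph := inl (line_point s b t).
have f_inj : injective f by move=> x y [] /line_point_inj.
rewrite -(card_imset _ f_inj); apply: subset_leq_card.
by apply/fintype.subsetP => _ /imsetP[t _ ->]; rewrite inE /= intercept_line_point.
Qed.

Lemma plane_degree_le (v : plane_graph) : (#|nbhd v| <= 2 * #|F|.+1)%N.
Proof.
case: v => [p|l]; first by rewrite card_nbhd_point.
by apply: leq_trans (card_nbhd_line_le l) _; rewrite leq_mul2l leqnSn.
Qed.

(** A point is dominated by a line joining it to [p]. A line avoiding [p] is dominated by the other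
    copy of its parallel through [p]. *)
Lemma plane_dominating p : dominating (nbhd (inl p : plane_graph)).
Proof.
apply/forallP => -[p'|[i [s b]]]; apply/implyP; rewrite inE /= => nadj.
  have [s pp'] := points_join p p'; apply/existsP.
  by exists (inr (true, (s, intercept p s))); rewrite inE /= pp' eqxx.
apply/existsP; exists (inr (~~ i, (s, intercept p s))).
by rewrite inE /= !eqxx /= [b == _]eq_sym nadj andbT; case: i.
Qed.

Lemma plane_card_ge : (#|F| <= #|plane_graph|)%N.
Proof. by rewrite card_plane; nia. Qed.

Lemma plane_min_degree_bounds :
  (#|F| <= min_degree plane_graph <= 2 * #|F|.+1)%N.
Proof.
rewrite min_degree_ge ?plane_card_ge //=.
  by rewrite -(card_nbhd_point (0, 0)) min_degree_le.
case=> [p|l]; last exact: card_nbhd_line_ge.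
by rewrite card_nbhd_point (leq_trans (leqnSn _)) // leq_pmull.
Qed.

Lemma plane_domination_bounds :
  (#|F| <= domination_number plane_graph <= 2 * #|F|.+1)%N.
Proof.
rewrite domination_number_ge ?plane_card_ge //=.
  rewrite -(card_nbhd_point (0, 0)).
  exact: domination_number_le (plane_dominating _).
move=> D /(card_le_dominating plane_degree_le); rewrite card_plane.
(* Here 3q^2 + 2q <= d (2q + 3), whereas d <= q - 1 would make the right side at most 2q^2 + q -
   3. *)
by move: #|D| #|F| => d q; case: leqP => // dq; nia.
Qed.

(** * Irreducibility and diameter of the plane graph *)

Hypothesis F3 : (2 < #|F|)%N.

Lemma plane_irreducible : irreducible plane_graph.
Proof.
apply: irreducibleI; first exact: plane_no_triangle.
move=> [p|[i [s b]]] [p'|[j [t c]]] neq.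
- have [s ps] := @points_separated p p' neq.
  by exists (inr (true, (s, intercept p s))); rewrite /= ?eqxx // eq_sym.
(* Lines in the same copy [j] are never adjacent. *)
- by exists (inr (j, (None, intercept p None))); rewrite /= eqxx.
(* A parallel other than the line itself and missing [p']. *)
- have [d db dp] := exists_neq2 b (intercept p' s) F3.
  exists (inr (~~ i, (s, d))); rewrite /= ?eqxx /=; last by rewrite eq_sym.
  by rewrite [b == d]eq_sym db andbT; case: i {neq}.
- have [[st bc]|ne] := eqVneq (s, b) (t, c); last first.
    have [p ps pt] := lines_separated ne.
    by exists (inl p) => //=; apply/eqP.
  (* For two copies of one line, any other parallel in copy [~~ i], which is [j], separates them. *)
  subst t c; have [d db _] := exists_neq2 b b F3.
  exists (inr (~~ i, (s, d))); rewrite /= ?eqxx /= [b == d]eq_sym db andbT.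
    by case: i {neq}.
  by case: i j neq => [] []; rewrite ?eqxx.
Qed.

Lemma plane_diam : is_diam plane_graph 2.
Proof.
apply: (@is_diam2I plane_graph (inl (0, 0)) (inl (1, 0))) => //.
  apply/eqP => -[] /eqP; by rewrite eq_sym oner_eq0.
move=> [p|[i [s b]]] [p'|[j [t c]]] neq /= nadj.
- have [s pp'] := points_join p p'.
  by exists (inr (true, (s, intercept p s))); rewrite /= ?pp'.
- exists (inr (~~ j, (t, intercept p t))); rewrite /= ?eqxx // nadj.
  by case: j {neq nadj}.
- exists (inr (~~ i, (s, intercept p' s))); rewrite /= ?eqxx //.
  by rewrite /= [b == _]eq_sym nadj andbT; case: i {neq nadj}.
- have [st|st] := eqVneq s t; last first.
    have [p ps pt] := lines_meet b c st.
    by exists (inl p); apply/eqP.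
  subst t; have [bc|bc] := eqVneq b c.
    subst c; exists (inl (line_point s b 0));
      by rewrite /= intercept_line_point.
  (* Distinct nonadjacent parallels lie in the same copy; a third parallel in the other copy is
     adjacent to both. *)
  rewrite eqxx bc !andbT negbK in nadj.
  have [d db dc] := exists_neq2 b c F3.
  exists (inr (~~ i, (s, d))); rewrite /= !eqxx ?[b == d]eq_sym ?db ?dc.
    by case: i {neq nadj}.
  by rewrite -(eqP nadj); case: i {neq nadj}.
Qed.

End AffinePlane.

(** * Choice of the field and asymptotics *)

Lemma bigTheta_of_bounds (R : realType) (f : nat -> nat) (g : nat -> R)
    (a b : R) :
  0 < a -> 0 < b -> (forall n, 0 <= g n) ->
  (forall n : nat, (1 <= n)%N -> a * g n <= (f n)%:R <= b * g n) ->
  (fun n => (f n)%:R : R^o) \is 'Theta_\oo (fun n => g n : R^o).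
Proof.
move=> a0 b0 g0 fg; apply/asboolP; exists (a, b); first by rewrite /= a0 b0.
exists 1%N => // n /= n1.
rewrite [`|g n|]ger0_norm // [`|_%:R|]ger0_norm //.
exact/andP/fg.
Qed.

(* [field_of n] has q elements with n <= q^2 <= 16 n; taking q >= 4 ensures that
   two parallel lines always have a third parallel. *)
Definition field_of (n : nat) : finFieldType :=
  s2val (pPrimePowerField (isT : prime 2) (ltn0Sn (trunc_log 4 n).+1)).

Lemma card_field_of n : #|field_of n| = (2 ^ (trunc_log 4 n).+2)%N.
Proof. by rewrite /field_of; case: pPrimePowerField. Qed.

Lemma card_field_of_gt2 n : (2 < #|field_of n|)%N.
Proof. by rewrite card_field_of (@ltn_exp2l 2 1). Qed.

Lemma card_field_of_bounds n :
  (1 <= n)%N -> (n <= #|field_of n| ^ 2 <= 16 * n)%N.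
Proof.
move=> n1; have /andP[] := trunc_log_bounds (isT : (1 < 4)%N) n1.
(* With m the largest power of 4 up to n, q^2 = 16 m and m <= n < 4 m. *)
rewrite card_field_of expnAC -[(2 ^ 2)%N]/4%N !(expnS 4).
by move: (4 ^ _)%N => m; lia.
Qed.

Theorem theorem2 (R : realType) :
  exists G : nat -> sgraph,
    [/\ forall n : nat, (1 <= n)%N ->
          [/\ irreducible (G n), triangle_free (G n), colorable 3 (G n)
            & is_diam (G n) 2],
        (fun n : nat => #|G n|%:R : R^o)
          \is 'Theta_\oo (fun n : nat => n%:R : R^o),
        (fun n : nat => (min_degree (G n))%:R : R^o)
          \is 'Theta_\oo (fun n : nat => Num.sqrt (n%:R : R) : R^o)
      & (fun n : nat => (domination_number (G n))%:R : R^o)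
          \is 'Theta_\oo (fun n : nat => Num.sqrt (n%:R : R) : R^o)].
Proof.
have sqrt_bounds (f : nat -> nat) :
    (forall n, #|field_of n| <= f n <= 2 * #|field_of n|.+1)%N ->
    (fun n => (f n)%:R : R^o)
      \is 'Theta_\oo (fun n : nat => Num.sqrt (n%:R : R) : R^o).
  (* From q <= 4 sqrt n follows 2 (q + 1) <= 4 q <= 16 sqrt n; both bounds are checked after
     squaring. *)
  move=> fq; apply: (@bigTheta_of_bounds R f _ 1 16) => // n n1.
  have [q1 q2] := andP (card_field_of_bounds n1).
  have [f1 f2] := andP (fq n); have q3 := card_field_of_gt2 n.
  apply/andP; split.
    rewrite mul1r -[leRHS]ger0_norm // -sqrtr_sqr ler_wsqrtr //.
    by rewrite -natrX ler_nat; nia.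
  rewrite -(ger0_norm (ler0n R 16)) -sqrtr_sqr -sqrtrM ?sqr_ge0 //.
  rewrite -[leLHS]ger0_norm // -sqrtr_sqr ler_wsqrtr //.
  rewrite -!natrX -natrM ler_nat; nia.
exists (fun n => plane_graph (field_of n)); split.
- move=> n _; have q3 := card_field_of_gt2 n; split.
  + exact: plane_irreducible.
  + exact/triangle_freeI/plane_no_triangle.
  + exact: plane_colorable.
  + exact: plane_diam.
(* The constant 80 comes from 3q^2 + 2q <= 5q^2 and q^2 <= 16 n. *)
- apply: (@bigTheta_of_bounds R (fun n => #|plane_graph (field_of n)|) _ 1 80)
    => // n n1.
  have [q1 q2] := andP (card_field_of_bounds n1); have q3 := card_field_of_gt2 n.
  by rewrite mul1r -natrM !ler_nat card_plane; apply/andP; split; nia.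
- by apply: sqrt_bounds => n; exact: plane_min_degree_bounds.
- by apply: sqrt_bounds => n; exact: plane_domination_bounds.
Qed.
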